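(* (1) The sets $\mathscr{D}$ and $\mathscr{D}_{st}$ are well-ordered, each of order type $\omega^\omega$; for every nonnegative integer $k$ the set $\mathscr{D}_{st}\cap[0,k]$ has order type $\omega^k$, and for $k\ne1$ so does $\mathscr{D}\cap[0,k]$. (2) The closures $\overline{\mathscr{D}_{st}}$ and $\overline{\mathscr{D}}$ (in $\mathbb{R}$) are well-ordered, each of order type $\omega^\omega$; for every integer $k\ge1$ the sets $\overline{\mathscr{D}_{st}}\cap[0,k]$ and $\overline{\mathscr{D}}\cap[0,k]$ have order type $\omega^k+1$, and both contain $k$, so $k$ is the $\omega^k$'th element of both. (3) For $a=0,1,2$, the sets $\mathscr{D}^a$ and $\mathscr{D}^a_{st}$ are well-ordered, each of order type $\omega^\omega$; if $k$ is a nonnegative integer with $a\equiv k\pmod 3$, then $\mathscr{D}^a\cap[0,k]$ and $\mathscr{D}^a_{st}\cap[0,k]$ have order type $\omega^k$. (4) For $a=0,1,2$, the closures $\overline{\mathscr{D}^a}$ and $\overline{\mathscr{D}^a_{st}}$ are well-ordered, each of order type $\omega^\omega$; if $k\ge1$ and $a\equiv k\pmod 3$, then $\overline{\mathscr{D}^a}\cap[0,k]$ and $\overline{\mathscr{D}^a_{st}}\cap[0,k]$ have order type $\omega^k+1$, and each contains $k$, so $k$ is the $\omega^k$'th element of each.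
   Context: $\|n\|$ is the complexity of a positive integer $n$: the least number of $1$'s needed to write $n$ using $1$, $+$, $\times$ and parentheses; $\delta(n)=\|n\|-3\log_3 n$ is its defect; $\mathscr{D}=\{\delta(n):n\ge1\}$. A positive integer $m$ is stable if $\|3^km\|=3k+\|m\|$ for all $k\ge1$; $\mathscr{D}_{st}$ is the set of defects of stable numbers. For a congruence class $a$ mod $3$, $\mathscr{D}^a=\{\delta(n):\|n\|\equiv a\pmod 3,\ n\ne1\}$ and $\mathscr{D}^a_{st}=\mathscr{D}^a\cap\mathscr{D}_{st}$. All sets are subsets of $\mathbb{R}$ with the usual order and topology; elements of a well-ordered set are indexed by ordinals starting from $0$. *)

(* Defs.v *)
From HB Require Import structures.
From mathcomp Require Import all_boot all_order all_algebra finmap.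
From mathcomp Require Import all_classical all_reals all_analysis.
From mathcomp Require wochoice.

Set Implicit Arguments.
Unset Strict Implicit.
Unset Printing Implicit Defensive.

Import Order.TTheory GRing.Theory Num.Theory.
Import numFieldNormedType.Exports.

Local Open Scope classical_set_scope.
Local Open Scope ring_scope.

Inductive expr : Type :=
  | One
  | Add of expr & expr
  | Mul of expr & expr.

Fixpoint value (e : expr) : nat :=
  match e with
  | One => 1
  | Add e1 e2 => value e1 + value e2
  | Mul e1 e2 => value e1 * value e2
  end.

Fixpoint ones (e : expr) : nat :=
  match e with
  | One => 1
  | Add e1 e2 | Mul e1 e2 => ones e1 + ones e2
  end.

Definition writable (n c : nat) : bool :=
  `[< exists e : expr, value e = n /\ ones e = c >].

Lemma ex_writable (n : nat) : exists c, (n == 0)%N || writable n c.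
Proof.
elim: n => [|[_|n [c /asboolP[e [ve _]]]]]; first by exists 0%N.
  by exists 1%N; apply/asboolP; exists One.
exists (ones (Add One e)); apply/asboolP; exists (Add One e).
by split => //=; rewrite ve.
Qed.

(* The value at 0, which no expression denotes, is the junk value 0. *)
Definition complexity (n : nat) : nat := ex_minn (ex_writable n).

Definition stable (m : nat) : Prop :=
  (0 < m)%N /\
  forall k, (1 <= k)%N -> complexity (3 ^ k * m) = (3 * k + complexity m)%N.

Section Defects.
Variable R : realType.

Definition defect (n : nat) : R :=
  (complexity n)%:R - 3 * (ln n%:R / ln 3).

Definition defects : set R := [set defect n | n in [set n | (1 <= n)%N]].

Definition stable_defects : set R := [set defect n | n in stable].

Definition defects_mod (a : nat) : set R :=
  [set defect n | n in
    [set n | [/\ (1 <= n)%N, complexity n = a %[mod 3] & n <> 1%N]]].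

Definition stable_defects_mod (a : nat) : set R :=
  defects_mod a `&` stable_defects.

End Defects.

Arguments defect R n : clear implicits.
Arguments defects R : clear implicits.
Arguments stable_defects R : clear implicits.
Arguments defects_mod R a : clear implicits.
Arguments stable_defects_mod R a : clear implicits.

(* An ordinal is represented by a strictly ordered type of that order type. *)
Record ordinal_model := OrdinalModel {
  om_sort :> Type;
  om_lt : om_sort -> om_sort -> Prop
}.

(* The textbook model of omega ^ beta, where beta is the order type of B:
   finitely supported functions B -> omega, compared at the largest argument
   where they differ. Thus omega_pow 'I_k is omega ^ k and omega_pow nat is
   omega ^ omega. *)
Definition omega_pow (d : Order.disp_t) (B : orderType d) : ordinal_model :=
  @OrdinalModel {fsfun B -> nat with 0%N}
    (fun f g => exists b : B,
       (f b < g b)%N /\ forall c : B, (b < c)%O -> f c = g c).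

(* alpha + 1: a new greatest element None is added to alpha. *)
Definition succ_ordinal (alpha : ordinal_model) : ordinal_model :=
  @OrdinalModel (option alpha)
    (fun x y => match x, y with
                | Some u, Some v => om_lt u v
                | Some _, None => True
                | None, _ => False
                end).

Section SetsOfReals.
Variable R : realType.

Definition well_ordered (S : set R) : Prop :=
  wochoice.wo_chain <=%R [pred x | x \in S].

Definition has_order_type (S : set R) (alpha : ordinal_model) : Prop :=
  exists f : alpha -> R,
    set_bij [set: alpha] S f /\ (forall x y, om_lt x y <-> f x < f y).

(* With indexing from 0, the alpha'th element of S is the one whose strict
   predecessors in S have order type alpha. *)
Definition is_nth_element (S : set R) (alpha : ordinal_model) (x : R) : Prop :=
  S x /\ has_order_type (S `&` [set y | y < x]) alpha.

End SetsOfReals.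

(* Main.v *)
Require Import Defs.
From HB Require Import structures.
From mathcomp Require Import all_boot all_order all_algebra finmap.
From mathcomp Require Import all_classical all_reals all_analysis.
From mathcomp Require Import zify ring lra.
Import Order.TTheory GRing.Theory Num.Theory.
Import numFieldNormedType.Exports.
Local Open Scope classical_set_scope.
Local Open Scope ring_scope.
Set Implicit Arguments.
Unset Strict Implicit.
Unset Printing Implicit Defensive.

(** Let M be the set of all values ones e - 3 log_3 (value e), e an expression;
    M is closed under addition, and every set in the theorem lies between the
    stable defects of one class mod 3 and the closure E of M.

    Numbers of bounded defect are built from finitely many pieces: the positive
    defects are bounded away from 0, and in an optimal sum a + b with b <= a the
    term b is bounded while, as a grows, the defect of the sum approaches
    defect a + complexity b from below. Following such decompositions along an
    ultrafilter shows that bounded defects either become constant or increase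
    strictly to a limit x with x - 1 in E. So E is well-ordered, and an embedding
    of omega ^ (k + 1) into E below s yields one of omega ^ k below s - 1, whence
    s >= k + 1.

    Conversely, for m stable, 3 ^ j m + 1 is stable of complexity
    complexity m + 3 j + 1 for all large j: otherwise a limit of defects would
    put defect m - i in E for some i >= 1, which descends to a negative element
    of E. Its defects increase to defect m + 1, and iterating from m = 3 embeds
    omega ^ k just below k, in the class of k mod 3. *)

(** * Integer complexity *)

Lemma value_gt0 e : (0 < value e)%N.
Proof.
by elim: e => //= e1 h1 e2 h2; rewrite ?addn_gt0 ?h1 // muln_gt0 h1 h2.
Qed.

Lemma complexity_value e : (complexity (value e) <= ones e)%N.
Proof.
rewrite /complexity; case: ex_minnP => c _; apply; apply/orP; right.
by apply/asboolP; exists e.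
Qed.

Lemma complexity_witness n : (0 < n)%N ->
  exists e, value e = n /\ ones e = complexity n.
Proof.
move=> n0; rewrite /complexity; case: ex_minnP => c.
by rewrite -[n == 0%N]negbK -lt0n n0 => /asboolP.
Qed.

Lemma complexity_add a b : (0 < a)%N -> (0 < b)%N ->
  (complexity (a + b) <= complexity a + complexity b)%N.
Proof.
move=> /complexity_witness [e [<- <-]] /complexity_witness [f [<- <-]].
exact: (complexity_value (Add e f)).
Qed.

Lemma complexity_mul a b : (0 < a)%N -> (0 < b)%N ->
  (complexity (a * b) <= complexity a + complexity b)%N.
Proof.
move=> /complexity_witness [e [<- <-]] /complexity_witness [f [<- <-]].
exact: (complexity_value (Mul e f)).
Qed.

Lemma complexity_gt0 n : (0 < n)%N -> (0 < complexity n)%N.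
Proof.
move=> /complexity_witness [e [_ <-]].
by elim: e => //= e1 h1 e2 h2; rewrite addn_gt0 h1.
Qed.

Lemma complexity1 : complexity 1 = 1%N.
Proof.
apply/eqP; rewrite eqn_leq complexity_gt0 // andbT.
exact: (complexity_value One).
Qed.

(** The immediate subexpressions of an optimal expression are optimal. A factor 1 would waste a one,
    so in a product both factors are proper divisors, which permits induction on [n]. *)
Lemma complexity_split n : (1 < n)%N ->
  exists a b, [/\ (0 < a)%N, (0 < b)%N,
    complexity n = (complexity a + complexity b)%N &
    n = (a + b)%N \/ [/\ n = (a * b)%N, (a < n)%N & (b < n)%N]].
Proof.
move=> n1; have [[|e f|e f] [/= hn hc]] := complexity_witness (ltnW n1).
- by move: n1; rewrite -hn.
- rewrite -hn in hc *; exists (value e), (value f); rewrite !value_gt0; split=> //; last by left.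
  apply/eqP; rewrite eqn_leq complexity_add ?value_gt0 //= -hc.
  by rewrite leq_add ?complexity_value.
- rewrite -hn in hc *; exists (value e), (value f); rewrite !value_gt0.
  have he := complexity_value e; have hf := complexity_value f.
  have e0 := complexity_gt0 (value_gt0 e); have f0 := complexity_gt0 (value_gt0 f).
  split=> //; first by apply/eqP; rewrite eqn_leq complexity_mul ?value_gt0 //= -hc leq_add.
  right; split=> //.
    rewrite ltn_Pmulr ?value_gt0 // ltn_neqAle value_gt0 andbT.
    apply/negP => /eqP h; move: hc; rewrite -h muln1; lia.
  rewrite ltn_Pmull ?value_gt0 // ltn_neqAle value_gt0 andbT.
  apply/negP => /eqP h; move: hc; rewrite -h mul1n; lia.
Qed.

(* The constant 9/8 is attained at 2 = 1 + 1. *)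
Lemma value_cubed_gap e :
  (value e ^ 3 = 3 ^ ones e \/ 9 * value e ^ 3 <= 8 * 3 ^ ones e)%N.
Proof.
have ones_gt0 f : (0 < ones f)%N by elim: f => //= f hf g _; rewrite addn_gt0 hf.
have le_exp (c d : nat) : (c <= d)%N -> (3 ^ c <= 3 ^ d)%N by move=> h; rewrite leq_exp2l.
(* Adding 1 is treated apart because [a + b <= a * b] needs both terms to be at least 2. The tight
   case is 2 + 1 = 3. *)
have add_one a A B : (0 < a)%N -> (0 < A)%N -> (0 < B)%N ->
    (a ^ 3 = 3 ^ A \/ 9 * a ^ 3 <= 8 * 3 ^ A)%N ->
    ((a + 1) ^ 3 = 3 ^ (A + B) \/ 9 * (a + 1) ^ 3 <= 8 * 3 ^ (A + B))%N.
  move=> a0 A0 B0 h; have h' : (a ^ 3 <= 3 ^ A)%N by lia.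
  have hB := le_exp _ _ (leq_add (leqnn A) B0); rewrite expnD expn1 in hB.
  case: a a0 h h' => [//|[|[|a]]] _ h h'.
  - right; have := le_exp 2%N (A + B)%N; lia.
  - have A2 : (2 <= A)%N by case: A A0 h h' hB => [|[|A]].
    have [->|h3] : (A + B = 3 \/ 3 < A + B)%N by lia.
      by left.
    right; have := le_exp 4%N _ h3; lia.
  - right; rewrite !expnS !expn0 in h h' *; nia.
elim: e => [|e he f hf|e he f hf] /=.
- by right.
- have := value_gt0 e; have := value_gt0 f; have := ones_gt0 e; have := ones_gt0 f.
  move: (value e) (value f) (ones e) (ones f) he hf => a b A B ha hb B0 A0 b0 a0.
  have [->|b1] := eqVneq b 1%N; first exact: add_one.
  have [->|a1] := eqVneq a 1%N; first by rewrite addnC (addnC A); exact: add_one.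
  right; rewrite expnD.
  have [a2 b2] : (2 <= a)%N /\ (2 <= b)%N by lia.
  have ab : (a + b <= a * b)%N by nia.
  have ab3 : ((a + b) ^ 3 <= a ^ 3 * b ^ 3)%N by rewrite -expnMn leq_exp2r.
  have := expn_gt0 3 A; have := expn_gt0 3 B; rewrite /= => pB pA.
  case: ha => ha; last first.
    have {}hb : (b ^ 3 <= 3 ^ B)%N by lia.
    by have := leq_mul ha hb; lia.
  case: hb => hb; last first.
    by have := leq_mul (leqnn (a ^ 3)) hb; lia.
  (* Both terms are tight here: their cubes are powers of 3, hence odd, so both are at least 3 and
     [a + b] is at most two thirds of [a * b]. *)
  have a3 : (3 <= a)%N.
    case: a a2 {a0 a1 ab ab3} ha => [|[|[|a]]] // _ ha.
    by have := congr1 odd ha; rewrite !oddX /= orbT.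
  have b3 : (3 <= b)%N.
    case: b b2 {b0 b1 ab ab3} hb => [|[|[|b]]] // _ hb.
    by have := congr1 odd hb; rewrite !oddX /= orbT.
  rewrite -ha -hb -expnMn.
  have : (3 * (a + b) <= 2 * (a * b))%N by nia.
  by rewrite -(@leq_exp2r _ _ 3) // [X in (X <= _)%N]expnMn [X in (_ <= X)%N]expnMn; lia.
- have {}he' : (value e ^ 3 <= 3 ^ ones e)%N by lia.
  have {}hf' : (value f ^ 3 <= 3 ^ ones f)%N by lia.
  rewrite expnMn expnD; case: he => he; last by right; have := leq_mul he hf'; lia.
  case: hf => hf; first by left; rewrite he hf.
  by right; have := leq_mul he' hf; lia.
Qed.

Lemma complexity_cubed_gap n : (0 < n)%N ->
  (n ^ 3 = 3 ^ complexity n \/ 9 * n ^ 3 <= 8 * 3 ^ complexity n)%N.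
Proof. by move=> /complexity_witness [e [<- <-]]; exact: value_cubed_gap. Qed.

Lemma complexity_pow3_mul k n : (0 < n)%N ->
  (complexity (3 ^ k * n) <= 3 * k + complexity n)%N.
Proof.
move=> n0; elim: k => [|k IH]; first by rewrite mul1n.
have c3 : (complexity 3 <= 3)%N := complexity_value (Add One (Add One One)).
rewrite expnS -mulnA; apply: leq_trans (complexity_mul _ _) _ => //.
  by rewrite muln_gt0 expn_gt0.
lia.
Qed.

Lemma complexity_pow3 k : (0 < k)%N -> complexity (3 ^ k) = (3 * k)%N.
Proof.
case: k => // k _; apply/eqP; rewrite eqn_leq; apply/andP; split.
  have := @complexity_pow3_mul k 3 isT; rewrite -expnSr.
  have : (complexity 3 <= 3)%N := complexity_value (Add One (Add One One)).
  lia.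
have := @complexity_cubed_gap (3 ^ k.+1); rewrite expn_gt0 -expnM => /(_ isT) h.
rewrite mulnC -(@leq_exp2l 3) //; lia.
Qed.

Lemma stable3 : stable 3.
Proof.
split=> // k k1; rewrite -expnSr complexity_pow3 // (@complexity_pow3 1%N) //; lia.
Qed.

(** Comparing 3-adic valuations shows that [p] and [q] agree mod 3; the remaining power of 3 is a
    cube, and cube roots can be taken. *)
Lemma cubed_pow3_ratio m n p q : (0 < m)%N -> (0 < n)%N ->
  (m ^ 3 * 3 ^ p = n ^ 3 * 3 ^ q)%N ->
  exists s, (n = 3 ^ s * m)%N \/ (m = 3 ^ s * n)%N.
Proof.
move=> m0 n0 h.
have /(congr1 (logn 3)) := h.
rewrite (lognM _ (m := m ^ 3)) ?(lognM _ (m := n ^ 3)) ?expn_gt0 ?m0 ?n0 //.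
rewrite !lognX (@logn_prime 3 3) // eqxx !muln1 => hl.
have inj3 a b : (a ^ 3 = b ^ 3)%N -> a = b by move/eqP; rewrite eqn_exp2r // => /eqP.
have key a b s t : (a ^ 3 * 3 ^ t = b ^ 3 * 3 ^ (s * 3 + t))%N -> a = (3 ^ s * b)%N.
  rewrite expnD mulnA => /eqP; rewrite eqn_pmul2r ?expn_gt0 // expnM -expnMn mulnC.
  by move=> /eqP /inj3.
have [hv|hv] := leqP (logn 3 n) (logn 3 m).
  exists (logn 3 m - logn 3 n)%N; right; apply: (key _ _ _ p).
  by rewrite h; congr (_ * 3 ^ _)%N; lia.
exists (logn 3 n - logn 3 m)%N; left; apply: (key _ _ _ q).
by rewrite -h; congr (_ * 3 ^ _)%N; lia.
Qed.

(** * Limits of defects along ultrafilters *)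

Section UltraFilterFacts.
Variables (T : Type) (U : set_system T).
Hypothesis UU : UltraFilter U.

Lemma ultra_setU (A B : set T) : U (A `|` B) -> U A \/ U B.
Proof.
move=> UAB; have [|UA] := in_ultra_setVsetC A UU; first by left.
by right; apply: filterS (filterI UAB UA) => t [[At|//] nAt]; case: (nAt At).
Qed.

Lemma ultra_bounded_const (f : T -> nat) N :
  U [set t | (f t <= N)%N] -> exists c, U [set t | f t = c].
Proof.
elim: N => [|N IH] h.
  by exists 0%N; apply: filterS h => t /=; rewrite leqn0 => /eqP.
have /ultra_setU [|] : U ([set t | (f t <= N)%N] `|` [set t | f t = N.+1]).
- apply: filterS h => t /=; rewrite leq_eqVlt ltnS => /orP [/eqP|]; first by right.
  by left.
- exact: IH.
- by exists N.+1.
Qed.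

End UltraFilterFacts.

(** Turns witnesses at every scale [eta] into one ultrafilter along which the scale tends to 0. *)
Lemma ultrafilter_of_nested (R : realType) (T : Type) (B : R -> set T) :
  (forall eta, 0 < eta -> B eta !=set0) ->
  (forall eta eta', eta <= eta' -> B eta `<=` B eta') ->
  exists U : set_system T, UltraFilter U /\ forall eta, 0 < eta -> U (B eta).
Proof.
move=> B0 Bmono.
have PF : ProperFilter (filter_from [set eta : R | 0 < eta] B).
  apply: filter_from_proper; last by move=> eta; exact: B0.
  apply: filter_from_filter; first by exists 1 => /=.
  move=> i j /= i0 j0; exists (Num.min i j); first by rewrite /= lt_min i0.
  by move=> t Bt; split; apply: Bmono Bt; rewrite ge_min lexx ?orbT.
have [U [UU sub]] := ultraFilterLemma PF.
by exists U; split=> // eta eta0; apply: sub; exists eta.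
Qed.

(** * Defects, their gap above 0, and the closure of expression defects *)

Section Defect.
Variable R : realType.

Definition lg (n : nat) : R := ln n%:R / ln 3.

Lemma ln3_gt0 : 0 < ln (3 : R).
Proof. by apply: ln_gt0; rewrite ltr1n. Qed.

Lemma lgM a b : (0 < a)%N -> (0 < b)%N -> lg (a * b) = lg a + lg b.
Proof. by move=> a0 b0; rewrite /lg natrM lnM ?mulrDl // posrE ltr0n. Qed.

Lemma lgX a k : (0 < a)%N -> lg (a ^ k) = k%:R * lg a.
Proof.
by move=> a0; rewrite /lg natrX lnXn ?ltr0n // -[ln _ *+ _]mulr_natl mulrA.
Qed.

Lemma lg3X k : lg (3 ^ k) = k%:R.
Proof. by rewrite lgX // /lg divff ?mulr1 // gt_eqF ?ln3_gt0. Qed.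

Lemma lg_lt a b : (0 < a)%N -> (a < b)%N -> lg a < lg b.
Proof.
move=> a0 ab; rewrite /lg ltr_pM2r ?invr_gt0 ?ln3_gt0 // ltr_ln ?ltr_nat //.
  by rewrite posrE ltr0n.
by rewrite posrE ltr0n (leq_ltn_trans _ ab).
Qed.

Lemma lg_le a b : (0 < a)%N -> (a <= b)%N -> lg a <= lg b.
Proof.
by move=> a0; rewrite leq_eqVlt => /orP [/eqP ->//|/(lg_lt a0)/ltW].
Qed.

Lemma lg_inj a b : (0 < a)%N -> (0 < b)%N -> lg a = lg b -> a = b.
Proof.
move=> a0 b0 h; have [||//] := ltngtP a b.
  by move/(lg_lt a0); rewrite h ltxx.
by move/(lg_lt b0); rewrite h ltxx.
Qed.

Lemma lg_add_close b (eta : R) : 0 < eta ->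
  (* The threshold below comes from the bound ln (1 + b / a) <= b / a. *)
  exists N, forall a, (N < a)%N -> 3 * lg (a + b) - 3 * lg a < eta.
Proof.
move=> eta0; pose c := 3 * b%:R / (eta * ln 3) : R.
exists (Num.trunc c).+1 => a Na.
have a0 : 0 < a%:R :> R by rewrite ltr0n (leq_ltn_trans _ Na).
have ca : c < a%:R.
  by apply: lt_trans (truncnS_gt c) _; rewrite ltr_nat.
have l3 := ln3_gt0.
have -> : 3 * lg (a + b) - 3 * lg a = 3 * ln (1 + b%:R / a%:R) / ln 3.
  rewrite /lg; have -> : (1 + b%:R / a%:R : R) = (a + b)%:R / a%:R.
    by rewrite natrD; field; rewrite gt_eqF.
  rewrite ln_div ?posrE ?ltr0n ?addn_gt0 ?(leq_ltn_trans _ Na) //.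
  by field; rewrite gt_eqF.
rewrite ltr_pdivrMr //; apply: (@le_lt_trans _ _ (3 * (b%:R / a%:R))).
  rewrite ler_pM2l // le_ln1Dx // (@lt_le_trans _ _ 0) // divr_ge0 //; exact: ltW.
by move: ca; rewrite /c ltr_pdivrMr ?mulr_gt0 // mulrA ltr_pdivrMr //; lra.
Qed.

Local Notation defect := (defect R).

Lemma defectE n : defect n = (complexity n)%:R - 3 * lg n.
Proof. by []. Qed.

(** This is the defect of 2, the least positive defect by [defect_gap]. *)
Definition gap : R := 2 - 3 * lg 2.

Lemma gap_gt0 : 0 < gap.
Proof.
have : lg (2 ^ 3) < lg (3 ^ 2) by apply: lg_lt.
by rewrite lg3X lgX // /gap; lra.
Qed.

Lemma gap_le_half : gap <= 1 / 2.
Proof.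
have : lg (3 ^ 1) <= lg (2 ^ 2) by apply: lg_le.
by rewrite lg3X lgX // /gap; lra.
Qed.

Lemma defect_gap n : (0 < n)%N -> defect n = 0 \/ gap <= defect n.
Proof.
move=> n0; rewrite defectE; have [h|h] := complexity_cubed_gap n0.
  by left; have := lg3X (complexity n); rewrite -h lgX //; lra.
right; have h9 : lg (3 ^ 2 * n ^ 3) <= lg (2 ^ 3 * 3 ^ complexity n).
  by apply: lg_le; rewrite // muln_gt0 !expn_gt0 n0.
move: h9; rewrite (@lgM (3 ^ 2)) ?(@lgM (2 ^ 3)) ?expn_gt0 ?n0 //.
by rewrite !lg3X !lgX // /gap; lra.
Qed.

Lemma defect_ge0 n : (0 < n)%N -> 0 <= defect n.
Proof.
by move=> /defect_gap [->//|h]; apply: le_trans h; rewrite ltW ?gap_gt0.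
Qed.

Lemma defect1 : defect 1 = 1.
Proof. by rewrite defectE complexity1 /lg ln1; lra. Qed.

Lemma lg_le_complexity n : (0 < n)%N -> 3 * lg n <= (complexity n)%:R.
Proof. by move=> /defect_ge0; rewrite defectE subr_ge0. Qed.

(** A factor of defect 0 is stripped by induction, since the other factor then has the defect of
    [n]. In the product case that remains, each factor has its defect a full gap below that of
    [n]. *)
Lemma defect_split n : (0 < n)%N ->
  [\/ defect n = 1,
      exists a b, [/\ (0 < a)%N, (0 < b)%N, defect n = defect a + defect b,
        gap <= defect a & gap <= defect b] |
      exists a b, [/\ (0 < b)%N, (b <= a)%N &
        defect n = defect a + (complexity b)%:R - (3 * lg (a + b) - 3 * lg a)]].
Proof.
elim/ltn_ind: n => n IH n0; have [n1|n1] := leqP n 1.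
  by constructor 1; rewrite (_ : n = 1%N) ?defect1 //; lia.
have [a [b [a0 b0 hc [hn|[hn an bn]]]]] := complexity_split n1.
  constructor 3; have [ba|/ltnW ab] := leqP b a.
    by exists a, b; split=> //; rewrite !defectE hc -hn natrD; lra.
  by exists b, a; split=> //; rewrite !defectE hc hn (addnC b) natrD; lra.
have hd : defect n = defect a + defect b.
  by rewrite !defectE hc hn lgM // natrD; lra.
have [a0'|ha] := defect_gap a0.
  by move: hd; rewrite a0' add0r => ->; apply: IH.
have [b0'|hb] := defect_gap b0.
  by move: hd; rewrite b0' addr0 => ->; apply: IH.
by constructor 2; exists a, b.
Qed.

(* The defects of all expressions, optimal or not: padding an expression with
   factors 1 raises its number of ones by an arbitrary amount. *)
Definition expr_defects : set R :=
  [set x | exists n N : nat, (0 < n)%N /\ x = defect n + N%:R].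

Local Notation E := (closure expr_defects).

Lemma closure_near (A : set R) x :
  closure A x <-> forall eta, 0 < eta -> exists2 y, A y & `|x - y| < eta.
Proof.
split=> [Ax eta eta0|h B /nbhs_ballP [eta /= eta0 sB]].
  by have [y [Ay xy]] := Ax _ (nbhsx_ballx x eta eta0); exists y.
by have [y Ay xy] := h _ eta0; exists y; split=> //; apply: sB.
Qed.

Lemma expr_defects_ge0 x : expr_defects x -> 0 <= x.
Proof. by move=> [n [N [n0 ->]]]; rewrite addr_ge0 ?defect_ge0. Qed.

Lemma closure_expr_defects_ge0 x : E x -> 0 <= x.
Proof.
move=> /closure_near h; rewrite leNgt; apply/negP => x0.
have [|y /expr_defects_ge0 y0] := h (- x); first by lra.
by rewrite ltr_norml; lra.
Qed.

(** Multiply the two numbers; whatever the product saves over the sum of the complexities goes into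
    the padding. *)
Lemma expr_defectsD x y : expr_defects x -> expr_defects y -> expr_defects (x + y).
Proof.
move=> [a [A [a0 ->]]] [b [B [b0 ->]]].
have h := complexity_mul a0 b0.
exists (a * b)%N, (A + B + (complexity a + complexity b - complexity (a * b)))%N.
split; first by rewrite muln_gt0 a0.
by rewrite !defectE lgM // !natrD natrB // natrD; lra.
Qed.

Lemma closure_expr_defectsD x y : E x -> E y -> E (x + y).
Proof.
move=> /closure_near hx /closure_near hy; apply/closure_near => eta eta0.
have eta2 : 0 < eta / 2 by lra.
have [x' Mx xx] := hx _ eta2; have [y' My yy] := hy _ eta2.
exists (x' + y'); first exact: expr_defectsD.
by move: xx yy; rewrite !ltr_norml; lra.
Qed.

Lemma closure_expr_defectsDn x N : E x -> E (x + N%:R).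
Proof.
move=> /closure_near hx; apply/closure_near => eta eta0.
have [_ [n [K [n0 ->]]] xy] := hx _ eta0.
exists (defect n + K%:R + N%:R); last by move: xy; rewrite !ltr_norml; lra.
by exists n, (K + N)%N; rewrite natrD; split=> //; lra.
Qed.

Lemma defect_closure n : (0 < n)%N -> E (defect n).
Proof. by move=> n0; apply: subset_closure; exists n, 0%N; split=> //; lra. Qed.

(** * Ultralimits of bounded defects *)

Section Tame.
Variables (T : Type) (U : set_system T).
Hypothesis UU : UltraFilter U.

(** The two ways in which bounded defects behave along [U]. The clause [E (x - 1)] is carried with
    the limit case because it drives the later descents by 1. *)
Definition tame (g : T -> R) (x : R) : Prop :=
  E x /\ (U [set t | g t = x] \/
    E (x - 1) /\ forall eta, 0 < eta -> U [set t | x - eta < g t < x]).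

Lemma tame_le g x eta : tame g x -> 0 < eta -> U [set t | x - eta < g t <= x].
Proof.
move=> [_ [h|[_ h]]] eta0; last first.
  by apply: filterS (h _ eta0) => t /= /andP [-> /ltW].
by apply: filterS h => t /= ->; lra.
Qed.

Lemma eq_tame g h x : U [set t | g t = h t] -> tame h x -> tame g x.
Proof.
move=> gh [Ex [hx|[Ex1 hx]]]; split=> //.
  by left; apply: filterS (filterI gh hx) => t /= [->].
right; split=> // eta eta0.
by apply: filterS (filterI gh (hx _ eta0)) => t /= [->].
Qed.

(** If one summand is a strict limit from below, so is the sum; lowering the limit of that summand
    by 1 keeps the total in the closure by additivity. *)
Lemma tameD g h x y : tame g x -> tame h y -> tame (fun t => g t + h t) (x + y).
Proof.
move=> tg th; split; first by apply: closure_expr_defectsD; [case: tg|case: th].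
have sub eta (G H : set T) : 0 < eta -> U G -> U H ->
    (forall t, G t -> H t -> x + y - eta < g t + h t < x + y) ->
    U [set t | x + y - eta < g t + h t < x + y].
  by move=> eta0 UG UH GH; apply: filterS (filterI UG UH) => t [/GH]; apply.
have [[Ex [cx|[Ex1 lx]]] [Ey [cy|[Ey1 ly]]]] := (tg, th).
- by left; apply: filterS (filterI cx cy) => t /= [-> ->].
- right; split; first by rewrite -addrA; apply: closure_expr_defectsD.
  move=> eta eta0; apply: sub cx (ly _ eta0) _ => // t /= ->; lra.
- right; split; first by rewrite addrAC; apply: closure_expr_defectsD.
  move=> eta eta0; apply: sub (lx _ eta0) cy _ => // t /= + ->; lra.
- right; split; first by rewrite -addrA; apply: closure_expr_defectsD.
  move=> eta eta0; have eta2 : 0 < eta / 2 by lra.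
  apply: sub (lx _ eta2) (ly _ eta2) _ => // t /=; lra.
Qed.

(** Induction on the number of gaps above 0. The ultrafilter selects one alternative of
    [defect_split]: a product gives two families of smaller defect, and in a sum the small term is
    constant along [U] while the large one is either constant or unbounded. *)
Lemma tame_defect k (n : T -> nat) :
  U [set t | (0 < n t)%N /\ defect (n t) < k%:R * gap] ->
  exists x, tame (fun t => defect (n t)) x.
Proof.
elim: k n => [|k IH] n hn.
  have [t /= [/defect_ge0 n0]] := filter_ex hn.
  by rewrite mul0r ltNge n0.
have gap0 := gap_gt0; have gap2 := gap_le_half.
pose P2 t p := [/\ (0 < p.1)%N, (0 < p.2)%N,
  defect (n t) = defect p.1 + defect p.2, gap <= defect p.1 & gap <= defect p.2].
pose P3 t p := [/\ (0 < p.2)%N, (p.2 <= p.1)%N & defect (n t) =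
  defect p.1 + (complexity p.2)%:R - (3 * lg (p.1 + p.2) - 3 * lg p.1)].
have select (P : T -> nat * nat -> Prop) : U [set t | exists p, P t p] ->
    exists f, U [set t | P t (f t)].
  move=> h; have /choice [f hf] : forall t, exists p, (exists p, P t p) -> P t p.
    move=> t; have [[p Pp]|np] := pselect (exists p, P t p); first by exists p.
    by exists (0, 0)%N.
  by exists f; apply: filterS h => t /hf.
have : U ([set t | defect (n t) = 1] `|` ([set t | exists p, P2 t p] `|`
          [set t | exists p, P3 t p])).
  apply: filterS hn => t /= [/defect_split [d1|[a [b h]]|[a [b h]]] _]; first by left.
    by right; left; exists (a, b).
  by right; right; exists (a, b).
move=> /(ultra_setU UU) [h1|/(ultra_setU UU) [/select [f hf]|/select [f hf]]].
- exists 1; split; last by left.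
  by rewrite -defect1; apply: defect_closure.
- have [|x tx] := IH (fst \o f).
    apply: filterS (filterI hn hf) => t /= [[_ h] [? ? hd ? ?]]; split=> //.
    by move: h; rewrite hd -natr1; lra.
  have [|y ty] := IH (snd \o f).
    apply: filterS (filterI hn hf) => t /= [[_ h] [? ? hd ? ?]]; split=> //.
    by move: h; rewrite hd -natr1; lra.
  exists (x + y); apply: eq_tame (tameD tx ty).
  by apply: filterS hf => t /= [_ _ ->].
- have [b hb] : exists b, U [set t | (f t).2 = b].
    (* As the second term is at most the first, the logarithmic loss is at most [3 * lg 2]; hence
       [r] bounds the complexity of the second term, and so its logarithm. *)
    pose r := k.+1%:R * gap + 3 * lg 2.
    apply: (ultra_bounded_const UU (N := (3 ^ (Num.trunc r).+1)%N)).
    apply: filterS (filterI hn hf) => t /= [[_ hr] [b0 ba hd]].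
    have a0 := leq_trans b0 ba.
    have hc : (complexity (f t).2)%:R < r.
      have : lg ((f t).1 + (f t).2) <= lg (2 * (f t).1).
        by apply: lg_le; lia.
      rewrite lgM // /r; have := defect_ge0 a0; lra.
    have {}hc : lg (f t).2 <= (Num.trunc r).+1%:R.
      have := truncnS_gt r; have := lg_le_complexity b0.
      have : 0 <= (Num.trunc r).+1%:R :> R by [].
      lra.
    rewrite leqNgt; apply/negP => /lg_lt; rewrite expn_gt0 => /(_ isT).
    by rewrite lg3X ltNge hc.
  have [[N /(ultra_bounded_const UU) [a ha]]|unb] :=
      pselect (exists N, U [set t | ((f t).1 <= N)%N]).
    have hconst : U [set t | E (defect (n t))].
      by apply: filterS hn => t [n0 _]; apply: defect_closure.
    pose x := defect a + (complexity b)%:R - (3 * lg (a + b) - 3 * lg a).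
    have hx : U [set t | defect (n t) = x].
      by apply: filterS (filterI hf (filterI ha hb)) => t /= [[_ _ ->] [-> ->]].
    exists x; split; last by left.
    by have [t /= [Et <-]] := filter_ex (filterI hconst hx).
  have large N : U [set t | (N < (f t).1)%N].
    have [|h] := in_ultra_setVsetC [set t | (N < (f t).1)%N] UU; first by [].
    by exfalso; apply: unb; exists N; apply: filterS h => t /= /negP; rewrite -leqNgt.
  (* Once the loss is below 1/2, the large term has defect smaller by more than 1/2, hence by more
     than [gap], and the induction hypothesis applies to it. *)
  have half : 0 < 1 / 2 :> R by lra.
  have hb0 : (0 < b)%N.
    by have [t /= [<- [? _ _]]] := filter_ex (filterI hb hf).
  have cb : 1 <= (complexity b)%:R :> R by rewrite ler1n complexity_gt0.
  have [N hN] := lg_add_close b half.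
  have [|y ty] := IH (fst \o f).
    apply: filterS (filterI (filterI hn hf) (filterI hb (large N))) => t /=.
    move=> [[[_ h] [b0 ba hd]] [eb /hN]]; split; first exact: leq_trans ba.
    by move: h; rewrite hd eb -natr1; lra.
  (* The loss is positive and tends to 0, so this limit is approached strictly from below; with one
     less for the complexity of [b] one gets the point 1 below it. *)
  exists (y + (complexity b)%:R); split.
    by apply: closure_expr_defectsDn; case: ty.
  right; split.
    have -> : y + (complexity b)%:R - 1 = y + (complexity b).-1%:R.
      by rewrite -subn1 natrB ?complexity_gt0 //; lra.
    by apply: closure_expr_defectsDn; case: ty.
  move=> eta eta0; have eta2 : 0 < eta / 2 by lra.
  have [K hK] := lg_add_close b eta2.
  apply: filterS (filterI (filterI hf (tame_le ty eta2)) (filterI hb (large K))) => t /=.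
  move=> [[[b0 ba ->] hy] [eb /hK]]; rewrite eb.
  have : lg (f t).1 < lg ((f t).1 + b) by apply: lg_lt; lia.
  lra.
Qed.

Lemma tame_expr_defect (t0 : T -> nat * nat) r :
  U [set t | (0 < (t0 t).1)%N /\ defect (t0 t).1 + (t0 t).2%:R < r] ->
  exists x, tame (fun t => defect (t0 t).1 + (t0 t).2%:R) x.
Proof.
move=> h.
have [N hN] : exists N, U [set t | (t0 t).2 = N].
  apply: (ultra_bounded_const UU (N := Num.trunc r)).
  apply: filterS h => t /= [/defect_ge0 d0 hr].
  rewrite leqNgt; apply/negP; rewrite -(ler_nat R).
  by have := truncnS_gt r; lra.
have [|x [Ex tx]] := @tame_defect (Num.trunc (r / gap)).+1 (fun t => (t0 t).1).
  apply: filterS h => t /= [n0 hr]; split=> //.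
  have := truncnS_gt (r / gap); rewrite ltr_pdivrMr ?gap_gt0 //.
  have : 0 <= (t0 t).2%:R :> R by [].
  lra.
exists (x + N%:R); split; first exact: closure_expr_defectsDn.
case: tx => [tx|[Ex1 tx]]; [left|right].
  by apply: filterS (filterI hN tx) => t /= [-> ->].
split; first by rewrite addrAC; apply: closure_expr_defectsDn.
by move=> eta /tx tx'; apply: filterS (filterI hN tx') => t /= [->]; lra.
Qed.

End Tame.

(** Otherwise an ultrafilter would carry expression defects down to [x] from strictly above, while a
    tame family never lies above its limit. *)
Lemma expr_defects_right_isolated x :
  exists2 eta, 0 < eta & forall y, expr_defects y -> ~ (x < y < x + eta).
Proof.
apply: contrapT => /forall2NP h.
pose B eta := [set p : nat * nat | (0 < p.1)%N /\ x < defect p.1 + p.2%:R < x + eta].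
have [eta eta0|eta eta' le p [p0 hp]|U [UU hU]] := @ultrafilter_of_nested R _ B.
- have [//|/existsNP [_ /not_implyP [[n [N [n0 ->]]] /contrapT hn]]] := h eta.
  by exists (n, N).
- by split=> //; lra.
have [|y [_ ty]] := @tame_expr_defect _ _ UU id (x + 1).
  by apply: filterS (hU 1 ltr01) => p [p0 /andP[]].
have xy : x < y.
  case: ty => [ty|[_ /(_ 1 ltr01) ty]].
    by have [p /= [<- [_ /andP[]]]] := filter_ex (filterI ty (hU 1 ltr01)).
  have [p /= [h1 [_ h2]]] := filter_ex (filterI ty (hU 1 ltr01)); lra.
have eta0 : 0 < (y - x) / 2 by lra.
case: ty => [ty|[_ /(_ _ eta0) ty]].
  by have [p /= [h1 [_ h2]]] := filter_ex (filterI ty (hU _ eta0)); lra.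
by have [p /= [h1 [_ h2]]] := filter_ex (filterI ty (hU _ eta0)); lra.
Qed.

(** Along a suitable ultrafilter the tame limit must be [x], and it is not attained, so the limit
    case of [tame] supplies the conclusion. *)
Lemma expr_defects_left_limit x :
  (forall eta, 0 < eta -> exists2 y, expr_defects y & x - eta < y < x) -> E (x - 1).
Proof.
move=> h.
pose B eta := [set p : nat * nat | (0 < p.1)%N /\ x - eta < defect p.1 + p.2%:R < x].
have [eta eta0|eta eta' le p [p0 hp]|U [UU hU]] := @ultrafilter_of_nested R _ B.
- by have [_ [n [N [n0 ->]]] hn] := h _ eta0; exists (n, N).
- by split=> //; lra.
have [|y [_ ty]] := @tame_expr_defect _ _ UU id x.
  by apply: filterS (hU 1 ltr01) => p [p0 /andP[]].
case: ty => [ty|[Ey ty]].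
  have [p /= [hy [_ h2]]] := filter_ex (filterI ty (hU 1 ltr01)).
  have yx : 0 < x - y by lra.
  by have [q /= [h1 [_ h3]]] := filter_ex (filterI ty (hU _ yx)); lra.
have [yx|xy|<-//] := ltgtP y x; exfalso.
  have yx' : 0 < x - y by lra.
  by have [q /= [h1 [_ h3]]] := filter_ex (filterI (ty _ yx') (hU _ yx')); lra.
have xy' : 0 < y - x by lra.
by have [q /= [h1 [_ h3]]] := filter_ex (filterI (ty _ xy') (hU _ xy')); lra.
Qed.

End Defect.

Arguments expr_defects R : clear implicits.

(** * Stable numbers *)

Section StableDefects.
Variable R : realType.
Local Notation defect := (defect R).
Local Notation lg := (@lg R).
Local Notation E := (closure (expr_defects R)).

Lemma closure_open_interval (A : set R) x a b :
  closure A x -> a < x < b -> exists2 y, A y & a < y < b.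
Proof.
move=> /closure_near h axb.
have [|y Ay xy] := h (Num.min (x - a) (b - x)); first by rewrite lt_min; lra.
exists y => //; move: xy; rewrite lt_min !ltr_norml => /andP []; lra.
Qed.

(** This is the well-ordering of the closure: an infimum that is not attained would have expression
    defects arbitrarily close on its right. *)
Lemma closure_expr_defects_min (X : set R) : X `<=` E -> X !=set0 ->
  exists2 x, X x & forall y, X y -> x <= y.
Proof.
move=> XE X0.
have lb : has_inf X.
  by split=> //; exists 0 => y /XE /closure_expr_defects_ge0.
have ge y : X y -> inf X <= y by move=> Xy; apply: ge_inf => //; case: lb.
have [Xi|nXi] := pselect (X (inf X)); first by exists (inf X).
have [eta eta0 iso] := expr_defects_right_isolated (inf X).
have [y Xy hy] := inf_adherent eta0 lb.
have hy' : inf X < y.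
  rewrite lt_neqAle ge // andbT; apply/eqP => eq; apply: nXi; by rewrite eq.
have [|z Mz hz] := closure_open_interval (XE _ Xy) (a := inf X) (b := inf X + eta).
  by rewrite hy' hy.
by case: (iso _ Mz).
Qed.

Lemma closure_expr_defects_left_limit x :
  (forall eta, 0 < eta -> exists2 y, E y & x - eta < y < x) -> E (x - 1).
Proof.
move=> h; apply: expr_defects_left_limit => eta /h [y Ey hy].
exact: closure_open_interval hy.
Qed.

(** Exponentiating to base 3 turns the equation into one between cubes times powers of 3. *)
Lemma defect_eq_mod_nat m n i : (0 < m)%N -> (0 < n)%N ->
  defect m = defect n + i%:R ->
  exists s, (n = 3 ^ s * m)%N \/ (m = 3 ^ s * n)%N.
Proof.
move=> m0 n0 h.
apply: (@cubed_pow3_ratio m n (complexity n + i) (complexity m)) => //.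
apply: (@lg_inj R); rewrite ?muln_gt0 ?expn_gt0 ?m0 ?n0 //.
rewrite (@lgM R (m ^ 3)) ?(@lgM R (n ^ 3)) ?expn_gt0 ?m0 ?n0 //.
by rewrite !lg3X !lgX //; move: h; rewrite !defectE natrD; lra.
Qed.

Lemma defect_pow3_mul s n : (0 < n)%N ->
  defect (3 ^ s * n) =
  (complexity (3 ^ s * n))%:R - (3 * s + complexity n)%:R + defect n.
Proof.
move=> n0; rewrite !defectE lgM ?expn_gt0 // lg3X natrD natrM; lra.
Qed.

Lemma defect_pow3_mul_le s n : (0 < n)%N -> defect (3 ^ s * n) <= defect n.
Proof.
move=> n0; rewrite defect_pow3_mul //; have := complexity_pow3_mul s n0.
rewrite -(ler_nat R); lra.
Qed.

Lemma stable_pow3_mul m s : stable m ->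
  complexity (3 ^ s * m) = (3 * s + complexity m)%N.
Proof.
case: s => [|s] [m0 h]; first by rewrite mul1n.
exact: h.
Qed.

Lemma stable_defect_pow3_mul s m : stable m -> defect (3 ^ s * m) = defect m.
Proof.
by move=> sm; rewrite defect_pow3_mul ?stable_pow3_mul //; [lra|case: sm].
Qed.

(** The two numbers would differ by a power of 3, but multiplying by such a power never raises a
    defect and fixes that of a stable number. *)
Lemma stable_defect_neq m n i : stable m -> (0 < n)%N -> (0 < i)%N ->
  defect m <> defect n + i%:R.
Proof.
move=> sm n0 i0 h; have m0 : (0 < m)%N by case: sm.
have {}i0 : 0 < i%:R :> R by rewrite ltr0n.
have [s [hs|hs]] := defect_eq_mod_nat m0 n0 h; move: h.
  by rewrite hs stable_defect_pow3_mul //; lra.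
by have := defect_pow3_mul_le s n0; rewrite -hs; lra.
Qed.

(** Comparison with 1, whose defect is 1, makes [n] a power of 3, and proper powers of 3 have defect
    0. This is what lets sections at [k] be taken open or closed alike. *)
Lemma defect_eq_nat n k : (0 < n)%N -> (0 < k)%N -> defect n = k%:R -> n = 1%N.
Proof.
move=> n0 k0 h.
have k0' : 0 < k%:R :> R by rewrite ltr0n.
have [|s [hs|hs]] := @defect_eq_mod_nat n 1 k.-1 n0 isT.
- by rewrite defect1 -subn1 natrB // h; lra.
- by move/eqP: hs; rewrite eq_sym muln_eq1 => /andP [_ /eqP].
- case: s hs => [//|s] hs; exfalso; move: h.
  by rewrite hs muln1 defectE complexity_pow3 // lg3X natrM; lra.
Qed.

Lemma not_stable1 : ~ stable 1.
Proof.
by move=> [_ /(_ 1%N isT)]; rewrite muln1 (@complexity_pow3 1%N) // complexity1.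
Qed.

(* Descent: such a point is not itself the defect of an expression, hence is a
   limit of expression defects from below, so subtracting one more 1 stays in
   the closure; but the closure is nonnegative. *)
Lemma stable_defect_sub_notin m i : stable m -> (0 < i)%N -> ~ E (defect m - i%:R).
Proof.
(* The measure counts the values of [i] still possible, since [defect m - i%:R] must stay
   nonnegative. *)
move=> sm; have [n] := ubnP ((Num.trunc (defect m)).+1 - i)%N.
elim: n i => // n IH i hn i0 Ei.
have := closure_expr_defects_ge0 Ei => ge0.
have iM : (i <= Num.trunc (defect m))%N.
  rewrite -ltnS -(ltr_nat R); have := truncnS_gt (defect m); lra.
apply: (IH i.+1) => //; first by lia.
rewrite -natr1 opprD addrA; apply: expr_defects_left_limit => eta eta0.
have [eta' eta'0 iso] := expr_defects_right_isolated (defect m - i%:R).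
have [|y My hy] := closure_open_interval Ei
    (a := defect m - i%:R - eta) (b := defect m - i%:R + eta').
  by apply/andP; split; lra.
exists y => //; have [lt|gt|eq] := ltgtP y (defect m - i%:R).
- by lra.
- by exfalso; apply: (iso y) => //; lra.
- exfalso; case: My => k [N [k0 hy']].
  apply: (@stable_defect_neq m k (N + i)) => //; first by lia.
  by rewrite natrD; lra.
Qed.

(** The amount by which the defect of [3 ^ j * m + 1] lies below [defect m + 1] when its complexity
    is [complexity m + 3 * j + 1]. *)
Local Notation theta j m := (3 * lg (3 ^ j * m + 1) - 3 * lg (3 ^ j * m)).

Lemma theta_decr j m : (0 < m)%N -> theta j.+1 m < theta j m.
Proof.
move=> m0; have x0 : (0 < 3 ^ j * m)%N by rewrite muln_gt0 expn_gt0.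
rewrite expnS -mulnA; move: (3 ^ j * m)%N x0 => x x0.
have : lg ((3 * x + 1) * x) < lg ((x + 1) * (3 * x)).
  by apply: lg_lt; nia.
by rewrite !(@lgM R (_ + 1)) ?addn1 //; [lra|lia].
Qed.

Lemma theta_mono i j m : (0 < m)%N -> (i <= j)%N -> theta j m <= theta i m.
Proof.
move=> m0; elim: j => [|j IH]; first by rewrite leqn0 => /eqP ->.
rewrite leq_eqVlt ltnS => /orP [/eqP -> //|/IH]; apply: le_trans.
exact: ltW (theta_decr _ _).
Qed.

Lemma theta_gt0 j m : (0 < m)%N -> 0 < theta j m.
Proof.
move=> m0; have : lg (3 ^ j * m) < lg (3 ^ j * m + 1).
  by apply: lg_lt; rewrite ?muln_gt0 ?expn_gt0 ?addn1.
lra.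
Qed.

Lemma theta_cvg m eta : (0 < m)%N -> 0 < eta ->
  exists J, forall j, (J <= j)%N -> theta j m < eta.
Proof.
move=> m0 /(lg_add_close 1) [N hN]; exists N => j Nj; apply: hN.
apply: (leq_ltn_trans Nj); apply: (leq_trans (ltn_expl j (isT : 1 < 3)%N)).
exact: leq_pmulr.
Qed.

Definition good_step m j : Prop :=
  stable (3 ^ j * m + 1) /\ complexity (3 ^ j * m + 1) = (complexity m + 3 * j + 1)%N.

(** If no multiplication by a power of 3 ever beat the literal cost, all these complexities would be
    exact, and that is both stability and the required value. *)
Lemma good_stepN m j : (0 < m)%N -> ~ good_step m j ->
  exists l, (complexity (3 ^ l * (3 ^ j * m + 1)) < 3 * l + (complexity m + 3 * j + 1))%N.
Proof.
move=> m0 bad; set n := (3 ^ j * m + 1)%N.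
have n0 : (0 < n)%N by rewrite /n addn1.
apply: contrapT => /forallNP h.
have cn : (complexity n <= complexity m + 3 * j + 1)%N.
  have := @complexity_add (3 ^ j * m) 1; rewrite muln_gt0 expn_gt0 m0 complexity1.
  move=> /(_ isT isT); rewrite -/n; have := complexity_pow3_mul j m0; lia.
have all l : complexity (3 ^ l * n) = (3 * l + (complexity m + 3 * j + 1))%N.
  have /negP := h l; rewrite -leqNgt => h1; apply/eqP; rewrite eqn_leq h1 andbT.
  have := complexity_pow3_mul l n0; lia.
have cn' : complexity n = (complexity m + 3 * j + 1)%N.
  by have := all 0%N; rewrite mul1n.
by apply: bad; split=> //; split=> // k _; rewrite cn' all.
Qed.

(** A saving of [i] ones would put a defect exactly [theta j m] below [defect m + 1 - i%:R].
    Nonnegativity leaves finitely many [i], and none of these points is a limit from below, so a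
    small [theta j m] excludes every saving. *)
Lemma eventually_good_step m : stable m ->
  exists J, forall j, (J <= j)%N -> good_step m j.
Proof.
move=> sm; have m0 : (0 < m)%N by case: sm.
have iso I : exists2 eta, 0 < eta & forall i y, (0 < i <= I)%N ->
    expr_defects R y -> ~ (defect m + 1 - i%:R - eta < y < defect m + 1 - i%:R).
  elim: I => [|I [eta eta0 hI]]; first by exists 1 => // i y; lia.
  have [eta' eta'0 h'] : exists2 eta', 0 < eta' & forall y, expr_defects R y ->
      ~ (defect m + 1 - I.+1%:R - eta' < y < defect m + 1 - I.+1%:R).
    apply: contrapT => /forall2NP h; apply: (@stable_defect_sub_notin m I.+1) => //.
    have -> : defect m - I.+1%:R = defect m + 1 - I.+1%:R - 1 by lra.
    apply: expr_defects_left_limit => eta'' eta''0.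
    by have [//|/existsNP [y /not_implyP [My /contrapT hy]]] := h eta''; exists y.
  exists (Num.min eta eta'); first by rewrite lt_min eta0.
  move=> i y /andP [i0]; rewrite leq_eqVlt => /orP [/eqP ->|iI] My hy.
    apply: (h' y) => //; move: hy; have : Num.min eta eta' <= eta' by rewrite ge_min lexx orbT.
    lra.
  apply: (hI i y) => //; first by rewrite i0.
  have : Num.min eta eta' <= eta by rewrite ge_min lexx.
  lra.
have [eta eta0 hI] := iso (Num.trunc (defect m + 1)).+1.
have [J hJ] := theta_cvg m0 eta0; exists J => j /hJ small.
apply: contrapT => /(good_stepN m0) [l hl].
set n := (3 ^ j * m + 1)%N in hl *; have n0 : (0 < n)%N by rewrite /n addn1.
set c := complexity _ in hl; pose i := (3 * l + (complexity m + 3 * j + 1) - c)%N.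
have pos : (0 < 3 ^ l * n)%N by rewrite muln_gt0 expn_gt0.
(* The exponent [l] cancels, so one bound on [theta j m] serves every [l]. *)
have hd : defect (3 ^ l * n) = defect m + 1 - i%:R - theta j m.
  rewrite !defectE -/c /i natrB; last exact: ltnW.
  rewrite lgM ?expn_gt0 // (@lgM R (3 ^ j) m) ?expn_gt0 // !lg3X !natrD -/n.
  lra.
have t0 := theta_gt0 j m0.
apply: (hI i (defect (3 ^ l * n))).
- have -> : (0 < i)%N by rewrite /i; lia.
  rewrite /= leqW // -ltnS -(ltr_nat R); have := defect_ge0 R pos.
  have := truncnS_gt (defect m + 1); lra.
- by exists (3 ^ l * n)%N, 0%N; split=> //; lra.
- by rewrite hd; apply/andP; split; lra.
Qed.

End StableDefects.

(** * Embeddings of powers of omega *)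

(* The ordinal omega ^ k, carried by arbitrary sequences of which only the
   entries below k are compared. *)
Definition lexlt (k : nat) (u v : nat -> nat) : Prop :=
  exists b, [/\ (b < k)%N, (u b < v b)%N & forall c, (b < c < k)%N -> u c = v c].

Lemma lexltS k u v : lexlt k.+1 u v -> (u k < v k)%N \/ u k = v k /\ lexlt k u v.
Proof.
move=> [b [bk uv h]]; move: bk; rewrite ltnS leq_eqVlt => /orP [/eqP <-|bk].
  by left.
right; split; first by apply: h; rewrite bk /=.
by exists b; split=> // c /andP [bc ck]; apply: h; rewrite bc ltnS ltnW.
Qed.

Section Embeddings.
Variable R : realType.
Local Notation defect := (defect R).
Local Notation E := (closure (expr_defects R)).

Lemma stable_defects_mod_intro m a : stable m -> complexity m = a %[mod 3] ->
  stable_defects_mod R a (defect m).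
Proof.
move=> sm hm; split; last by exists m.
exists m => //; split=> //; first by case: sm.
by move=> m1; move: sm; rewrite m1; exact: not_stable1.
Qed.

Lemma stable_defects_mod_eq a b : a = b %[mod 3] ->
  stable_defects_mod R a = stable_defects_mod R b.
Proof. by move=> ab; rewrite /stable_defects_mod /defects_mod ab. Qed.

(** The defects of the numbers 3 ^ j m + 1 increase to [defect m + 1]. A copy of omega ^ k is placed
    just below each of them shifted by [k], and the leading entry of the sequence selects the
    copy. *)
Lemma lex_embedding k m eta : stable m -> 0 < eta ->
  exists f : (nat -> nat) -> R,
    (forall u v, lexlt k u v -> f u < f v) /\
    (forall u, stable_defects_mod R (complexity m + k) (f u) /\
      defect m + k%:R - eta < f u <= defect m + k%:R).
Proof.
elim: k m eta => [|k IH] m eta sm eta0.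
  exists (fun=> defect m); split=> [u v [b []]//|u]; split.
    by apply: stable_defects_mod_intro; rewrite ?addn0.
  by apply/andP; split; lra.
have m0 : (0 < m)%N by case: sm.
pose n j := (3 ^ j * m + 1)%N.
pose th j := 3 * @lg R (3 ^ j * m + 1) - 3 * @lg R (3 ^ j * m).
have [J1 good] := eventually_good_step R sm.
have eta2 : 0 < eta / 2 by lra.
have [J2 small] := theta_cvg m0 eta2.
pose J := maxn J1 J2.
have hJ i : (J1 <= J + i)%N /\ (J2 <= J + i)%N.
  by rewrite /J; split; lia.
have stab i : stable (n (J + i)%N) by have [/good []] := hJ i.
have comp i : complexity (n (J + i)%N) = (complexity m + 3 * (J + i) + 1)%N.
  by have [/good []] := hJ i.
have dn i : defect (n (J + i)%N) = defect m + 1 - th (J + i)%N.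
  rewrite defectE comp /th (@lgM R (3 ^ (J + i)) m) ?expn_gt0 // lg3X defectE.
  by rewrite 2!natrD natrM /n; lra.
(* The second bound is the distance between consecutive defects, which keeps the copies disjoint;
   copy [i] hangs at index [J + i.+1] so that it has a predecessor at [J + i]. *)
pose e i := Num.min (eta / 2) (th (J + i)%N - th (J + i).+1).
have e0 i : 0 < e i by rewrite lt_min eta2 subr_gt0; apply: theta_decr.
have /choice [f hf] : forall i, exists f : (nat -> nat) -> R,
    (forall u v, lexlt k u v -> f u < f v) /\
    (forall u, stable_defects_mod R (complexity (n (J + i.+1)%N) + k) (f u) /\
      defect (n (J + i.+1)%N) + k%:R - e i < f u <= defect (n (J + i.+1)%N) + k%:R).
  by move=> i; apply: IH.
exists (fun u => f (u k) u); split=> [u v /lexltS [uv|[-> uv]]|u].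
- have [_ /(_ u) [_ /andP[_ hu]]] := hf (u k).
  have [_ /(_ v) [_ /andP[hv _]]] := hf (v k).
  apply: le_lt_trans hu (le_lt_trans _ hv); rewrite !dn.
  have : e (v k) <= th (J + v k)%N - th (J + (v k).+1)%N.
    by rewrite addnS ge_min lexx orbT.
  have : th (J + v k)%N <= th (J + (u k).+1)%N.
    by apply: theta_mono => //; rewrite leq_add2l.
  lra.
- by have [mono _] := hf (v k); apply: mono.
- have [_ /(_ u) [Du bnd]] := hf (u k); split.
    move: Du; rewrite comp (@stable_defects_mod_eq _ (complexity m + k.+1)%N) //.
    rewrite (_ : (_ + k = 3 * (J + (u k).+1) + (complexity m + k.+1))%N); last by lia.
    by rewrite -modnDml modnMr.
  have [_ /small] := hJ (u k).+1; have : 0 < th (J + (u k).+1)%N := theta_gt0 _ _ m0.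
  have : e (u k) <= eta / 2 by rewrite ge_min lexx.
  by move: bnd; rewrite dn -/(th _) -[k.+1%:R]natr1; lra.
Qed.

(* Each block of omega consecutive terms has a supremum of the form 1 + y with
   y in the closure, and these y form an embedding of omega ^ k. *)
Lemma lex_embedding_bound k s (f : (nat -> nat) -> R) :
  (forall u v, lexlt k u v -> f u < f v) -> (forall u, E (f u) /\ f u <= s) ->
  k%:R <= s.
Proof.
elim: k s f => [|k IH] s f mono bnd.
  by have [/closure_expr_defects_ge0 h1 h2] := bnd (fun=> 0%N); apply: le_trans h2.
(* The new entry goes to index 0, the least significant one, so varying [n] runs through one block
   of omega terms. *)
pose cons n (u : nat -> nat) := fun i => if i is j.+1 then u j else n.
have lt_head u n p : (n < p)%N -> f (cons n u) < f (cons p u).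
  by move=> np; apply: mono; exists 0%N; split=> // -[|c].
have lt_tail u v n p : lexlt k u v -> f (cons n u) < f (cons p v).
  move=> [b [bk uv h]]; apply: mono; exists b.+1; split=> // -[|c] //.
  by rewrite !ltnS; exact: h.
pose X u := [set f (cons n u) | n in [set: nat]].
have hX u : has_sup (X u).
  split; first by exists (f (cons 0%N u)), 0%N.
  by exists s => _ [n _ <-]; have [] := bnd (cons n u).
have ub u n : f (cons n u) < sup (X u).
  apply: (lt_le_trans (lt_head u _ _ (ltnSn n))).
  by apply: ub_le_sup; [case: (hX u)|exists n.+1].
suff : k%:R <= s - 1 by rewrite -natr1; lra.
apply: (IH _ (fun u => sup (X u) - 1)) => [u v uv|u].
  rewrite ltrD2r; apply: le_lt_trans (ub v 0%N).
  by apply: ge_sup; [case: (hX u)|move=> _ [n _ <-]; apply/ltW/lt_tail].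
split; last first.
  by rewrite lerD2r; apply: ge_sup; [case: (hX u)|move=> _ [n _ <-]; have [] := bnd (cons n u)].
apply: closure_expr_defects_left_limit => eta eta0.
have [_ [n _ <-] hn] := sup_adherent eta0 (hX u).
by exists (f (cons n u)); [have [] := bnd (cons n u)|rewrite hn ub].
Qed.

(** Transfinite recursion sends each argument to the least element of [S] above all earlier values.
    The embedding [e] keeps the recursion from running out of elements, and the last hypothesis
    keeps it from stopping short of all of [S]. *)
Lemma order_type_of_embedding (alpha : ordinal_model) (S : set R) (e : alpha -> R) :
  (forall X, X `<=` S -> X !=set0 -> exists2 x, X x & forall y, X y -> x <= y) ->
  (forall x y : alpha, [\/ x = y, om_lt x y | om_lt y x]) ->
  (forall x, S (e x)) -> (forall x y, om_lt x y -> e x < e y) ->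
  (forall s (g : alpha -> R), S s -> (forall x, S (g x) /\ g x < s) ->
     ~ (forall x y, om_lt x y -> g x < g y)) ->
  has_order_type S alpha.
Proof.
move=> wo tot Se emono nobound.
have wf : well_founded (@om_lt alpha).
  apply: contrapT => /existsNP [x0 nacc].
  have [||_ [x nx <-] xmin] := wo [set e x | x in [set x | ~ Acc (@om_lt alpha) x]].
  - by move=> _ [x _ <-].
  - by exists (e x0), x0.
  apply: nx; constructor=> y yx; apply: contrapT => ny.
  have : e x <= e y by apply: xmin; exists y.
  by rewrite leNgt emono.
(* The infimum is a minimum whenever the set is nonempty, because [S] is well-ordered; nonemptiness
   follows once [g] is bounded by [e]. *)
pose F (x : alpha) (rec : forall y, om_lt y x -> R) : R :=
  inf [set s | S s /\ forall y (yx : om_lt y x), rec y yx < s].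
pose g := Fix wf (fun=> R) F.
pose A (x : alpha) := [set s | S s /\ forall y, om_lt y x -> g y < s].
have gE x : g x = inf (A x).
  rewrite /g Fix_eq // => {}x r1 r2 h; rewrite /F; congr inf.
  apply/seteqP; split=> s [Ss hs]; split=> // y yx.
    by rewrite -h.
  by rewrite h.
have gmin x : (exists s, A x s) -> A x (g x) /\ forall s, A x s -> g x <= s.
  move=> ex; have [|z Az zmin] := wo (A x) _ ex; first by move=> s [].
  have lb : lbound (A x) z by move=> s /zmin.
  suff -> : g x = z by [].
  rewrite gE; apply/eqP; rewrite eq_le; apply/andP; split.
    by apply: ge_inf => //; exists z.
  by apply: lb_le_inf => //; exists z.
have gle x : A x (g x) /\ g x <= e x.
  elim/(well_founded_ind wf): x => x IH.
  have Ae : A x (e x).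
    by split=> // y yx; have [_ /le_lt_trans] := IH _ yx; apply; apply: emono.
  by have [|? h] := gmin x; [exists (e x)|split=> //; apply: h].
have gS x : S (g x) by have [[]] := gle x.
have gmono x y : om_lt x y -> g x < g y by have [[_ h] _] := gle y; exact: h.
(* The image of [g] is an initial segment of [S], so a missed element would lie above all of it. *)
have ginit s x : S s -> s < g x -> exists y, g y = s.
  move=> Ss; elim/(well_founded_ind wf): x => x IH sx.
  apply: contrapT => /forallNP ns.
  have : g x <= s.
    apply: (gmin x _).2; first by exists (g x); have [] := gle x.
    split=> // y yx; rewrite ltNge le_eqVlt; apply/negP => /orP [/eqP eq|lt].
      by apply: (ns y).
    by have [z] := IH _ yx lt; apply: ns.
  by rewrite leNgt sx.
have surj s : S s -> exists x, g x = s.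
  move=> Ss; apply: contrapT => ns; apply: (nobound s g) => // x; split=> //.
  have [//|lt|eq] := ltgtP (g x) s; first by case: ns; apply: ginit lt.
  by case: ns; exists x.
exists g; split; first split.
- by move=> x _; exact: gS.
- move=> x y _ _ gxy; have [//|/gmono|/gmono] := tot x y; by rewrite gxy ltxx.
- by move=> s /surj [x <-]; exists x.
- move=> x y; split; first exact: gmono.
  by have [->|//|/gmono/ltW] := tot x y; rewrite ?ltxx // leNgt => /negP.
Qed.

End Embeddings.

(** * Comparison of finitely supported functions *)

Lemma seq_has_max (d : Order.disp_t) (B : orderType d) (s : seq B) (x : B) :
  x \in s -> exists2 m, m \in s & forall y, y \in s -> (y <= m)%O.
Proof.
elim: s x => // a [|b s] IH x _.
  by exists a; rewrite ?mem_head // => y; rewrite inE => /eqP ->.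
have [m ms hm] := IH b (mem_head b s).
have [am|/ltW ma] := leP a m.
  exists m; first by rewrite inE ms orbT.
  by move=> y; rewrite inE => /orP [/eqP ->//|/hm].
exists a; first by rewrite mem_head.
by move=> y; rewrite inE => /orP [/eqP ->//|/hm/le_trans]; apply.
Qed.

(** Two such functions differ on a finite set only, and its greatest element decides. *)
Lemma omega_pow_total (d : Order.disp_t) (B : orderType d) (u v : omega_pow B) :
  [\/ u = v, om_lt u v | om_lt v u].
Proof.
rewrite /= in u v *.
pose D : seq B := [seq b <- (finsupp u ++ finsupp v) | u b != v b].
have mem_D b : u b != v b -> b \in D.
  move=> h; rewrite mem_filter h mem_cat /=; apply: contraT; rewrite negb_or => /andP [hu hv].
  by move: h; rewrite !fsfun_dflt ?eqxx.
have [eq|/existsNP [b0 /eqP /mem_D /seq_has_max [b]]] := pselect (u =1 v).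
  by constructor 1; apply/fsfunP.
rewrite mem_filter => /andP [ub _] bmax.
have above c : (b < c)%O -> u c = v c.
  by move=> bc; apply/eqP; apply/negPn/negP => /mem_D /bmax; rewrite leNgt bc.
have [lt|gt|eq] := ltngtP (u b) (v b); last by rewrite eq eqxx in ub.
  by constructor 2; exists b.
by constructor 3; exists b; split=> // c /above.
Qed.

(** Truncation makes the arbitrary sequences compared by [lexlt] into elements of [omega_pow]. *)
Definition restrict_to (d : Order.disp_t) (B : orderType d) (s : seq B)
    (u : B -> nat) : omega_pow B :=
  [fsfun b in [fset x in s]%fset => u b | 0%N].

Lemma restrict_toE (d : Order.disp_t) (B : orderType d) (s : seq B) u (b : B) :
  (restrict_to s u : {fsfun B -> nat with 0%N}) b = if b \in s then u b else 0%N.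
Proof. by rewrite fsfun_fun !inE. Qed.

(** * Order types *)

Section OrderTypes.
Variable R : realType.
Local Notation defect := (defect R).
Local Notation E := (closure (expr_defects R)).

Lemma stable_defects_neq_nat x k : stable_defects R x -> (0 < k)%N -> x <> k%:R.
Proof.
move=> [n sn <-] k0 h; have n0 : (0 < n)%N by case: sn.
by move: sn; rewrite (defect_eq_nat n0 k0 h); exact: not_stable1.
Qed.

(** From 3, of defect 0 and complexity 3, the embedding of omega ^ k lands just below [k] in the
    class of [k]. Conversely, a copy of omega ^ k in the closure has no upper bound below [k]. *)
Lemma order_type_omega_k k (S : set R) : (0 < k)%N ->
  (forall x, stable_defects_mod R k x -> x < k%:R -> S x) ->
  (forall x, S x -> E x /\ x < k%:R) ->
  has_order_type S (omega_pow 'I_k).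
Proof.
move=> k0 lower upper.
have [f [fmono fS]] := @lex_embedding R k 3 1 stable3 ltr01.
pose ext (u : omega_pow 'I_k) : nat -> nat :=
  fun i => if insub i is Some o then (u : {fsfun 'I_k -> nat with 0%N}) o else 0%N.
apply: (order_type_of_embedding (e := f \o ext)).
- by move=> X XS; apply: closure_expr_defects_min => x /XS /upper [].
- exact: omega_pow_total.
- move=> u /=; have [Du /andP[_]] := fS (ext u).
  rewrite (@stable_defects_mod_eq _ _ k) in Du; last first.
    by rewrite -modnDml (@complexity_pow3 1%N).
  rewrite defectE (@complexity_pow3 1%N) // (@lg3X R 1) => le.
  apply: lower => //; rewrite lt_neqAle; apply/andP; split; last by lra.
  by apply/eqP/stable_defects_neq_nat => //; case: Du.
- move=> u v [b [uv h]]; apply: fmono; exists b; split=> //.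
    by rewrite /ext !valK.
  move=> c /andP [bc ck]; rewrite /ext; case: insubP => // o _ oc.
  by apply: h; rewrite ltEord oc.
move=> s g /upper [_ sk] gS gmono.
suff : k%:R <= s by rewrite leNgt sk.
apply: (@lex_embedding_bound R k s (fun u => g (restrict_to (enum 'I_k) u))) => [u v|u].
  move=> [b [bk uv h]]; apply: gmono; exists (Ordinal bk).
  rewrite !restrict_toE !mem_enum; split=> // c; rewrite ltEord => bc.
  by rewrite !restrict_toE !mem_enum; apply: h; rewrite bc /=.
have [Sg lt] := gS (restrict_to (enum 'I_k) u).
by split; [case: (upper _ Sg)|exact: ltW].
Qed.

(** Functions are sorted by the length [top] of their support, and those of each length are embedded
    into an interval of their own. Conversely, a copy of omega ^ omega contains every omega ^ k and
    so is unbounded. *)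
Lemma order_type_omega_omega a (S : set R) :
  stable_defects_mod R a `<=` S -> S `<=` E -> has_order_type S (omega_pow nat).
Proof.
move=> lower upper.
have /choice [f hf] : forall K, exists f : (nat -> nat) -> R,
    (forall u v, lexlt K u v -> f u < f v) /\
    (forall u, stable_defects_mod R K (f u) /\ K%:R - 1 < f u <= K%:R).
  move=> K; have [f [fmono fS]] := @lex_embedding R K 3 1 stable3 ltr01.
  exists f; split=> // u; have [Du bnd] := fS u; split.
    rewrite (@stable_defects_mod_eq _ _ K) // in Du.
    by rewrite -modnDml (@complexity_pow3 1%N).
  by move: bnd; rewrite defectE (@complexity_pow3 1%N) // (@lg3X R 1); lra.
have /choice [top htop] : forall u : omega_pow nat, exists k,
    (forall j, (k <= j)%N -> (u : {fsfun nat -> nat with 0%N}) j = 0%N) /\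
    (0 < k -> (u : {fsfun nat -> nat with 0%N}) k.-1 != 0)%N.
  move=> u; pose P k := `[< forall j, (k <= j)%N -> (u : {fsfun nat -> nat with 0%N}) j = 0%N >].
  have exP : exists k, P k.
    exists (\max_(i <- finsupp (u : {fsfun nat -> nat with 0%N})) i).+1.
    apply/asboolP => j hj; apply: fsfun_dflt; apply/negP => hu.
    by move: hj; rewrite ltnNge => /negP; apply; exact: leq_bigmax_seq hu isT.
  exists (ex_minn exP); case: ex_minnP => k /asboolP Pk kmin; split=> // k0.
  apply/eqP => uk; suff /kmin : P k.-1 by lia.
  apply/asboolP => j kj; have [->//|jk] := eqVneq j k.-1; apply: Pk; lia.
(* The factor 3 keeps all values in class [a]; [K] also exceeds every support index and increases
   with [top], so the intervals from K - 1 to K are in the right order. *)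
pose K u := (3 * top u + a)%N.
apply: (order_type_of_embedding (e := fun u : omega_pow nat =>
    f (K u) (u : {fsfun nat -> nat with 0%N}))).
- by move=> X XS; apply: closure_expr_defects_min => x /XS /upper.
- exact: omega_pow_total.
- move=> u; have [_ /(_ u) [Du _]] := hf (K u); apply: lower.
  by rewrite (@stable_defects_mod_eq _ a (K u)) // /K -modnDml modnMr.
- move=> u v [b [uv h]].
  have [zu nu] := htop u; have [zv nv] := htop v.
  have bv : (b < top v)%N by rewrite ltnNge; apply/negP => /zv vb; rewrite vb in uv.
  have [lt|gt|eq] := ltngtP (top u) (top v).
  + have [_ /(_ u) [_ /andP[_ hu]]] := hf (K u).
    have [_ /(_ v) [_ /andP[hv _]]] := hf (K v).
    apply: le_lt_trans hu (le_lt_trans _ hv).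
    by rewrite lerBrDr natr1 ler_nat /K; lia.
  + exfalso; have gt0 : (0 < top u)%N by lia.
    have := nu gt0; rewrite h ?zv ?eqxx //; first by lia.
    by rewrite ltEnat /=; lia.
  + rewrite /K eq; have [mono _] := hf (3 * top v + a)%N; apply: mono.
    by exists b; split=> //; [lia|move=> c /andP [bc _]; apply: h].
move=> s g /upper Es gS gmono.
have [k sk] : exists k, s < k%:R by exists (Num.trunc s).+1; exact: truncnS_gt.
suff : k%:R <= s by rewrite leNgt sk.
apply: (@lex_embedding_bound R k s (fun u => g (restrict_to (iota 0 k) u))) => [u v|u].
  move=> [b [bk uv h]]; apply: gmono; exists b.
  rewrite !restrict_toE !mem_iota /= bk; split=> // c bc.
  rewrite !restrict_toE !mem_iota /= add0n; case: ifP => // ck.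
  by apply: h; rewrite ck andbT.
have [Sg lt] := gS (restrict_to (iota 0 k) u).
by split; [exact: upper|exact: ltW].
Qed.

Lemma well_ordered_closure_expr_defects (S : set R) : S `<=` E -> well_ordered S.
Proof.
move=> SE; apply: wochoice.antisymmetric_wo_chain.
  by move=> x y _ _; exact: le_anti.
move=> A AS [x Ax].
have [y|//|z Az zmin] := closure_expr_defects_min (X := [set x | x \in A]).
- by move=> /= /AS; rewrite !inE => /SE.
- by exists x.
- by exists z; split=> // y /zmin.
Qed.

Lemma order_type_omega_succ k (S : set R) :
  has_order_type (S `&` [set y | y < k%:R]) (omega_pow 'I_k) -> S k%:R ->
  (forall x, S x -> 0 <= x) ->
  has_order_type (S `&` `[0, k%:R]) (succ_ordinal (omega_pow 'I_k)).
Proof.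
move=> [f [[fS finj fsurj] fmono]] Sk S0.
have flt u : f u < k%:R by have [] := fS u I.
exists (fun o : succ_ordinal (omega_pow 'I_k) => if o is Some u then f u else k%:R).
split; [split|].
- move=> [u|] _ /=; last by split=> //=; rewrite in_itv /= ler0n lexx.
  have [Su /= lt] := fS u I; split=> //=.
  by rewrite in_itv /= S0 // ltW.
- move=> [u|] [v|] _ _ //=; first by move/finj => ->; rewrite ?inE.
    by move=> h; have := flt u; rewrite h ltxx.
  by move=> h; have := flt v; rewrite h ltxx.
- move=> x [Sx /=]; rewrite in_itv /= => /andP [_]; rewrite le_eqVlt => /orP [/eqP ->|lt].
    by exists None.
  by have [u _ <-] := fsurj x (conj Sx lt); exists (Some u).
- move=> [u|] [v|] /=; first exact: fmono.
  + by split.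
  + by split=> // h; have := lt_trans h (flt v); rewrite ltxx.
  + by rewrite ltxx.
Qed.

(** * Sets between the stable defects of one class and the closure *)

Section Sandwich.
Variables (a : nat) (S : set R).
Hypotheses (lower : stable_defects_mod R a `<=` S) (upper : S `<=` E).

Lemma sandwich_order_type_lt k : (0 < k)%N -> a = k %[mod 3] ->
  has_order_type (S `&` [set y | y < k%:R]) (omega_pow 'I_k).
Proof.
move=> k0 ak; apply: order_type_omega_k => // x.
  by rewrite -(stable_defects_mod_eq R ak) => /lower.
by move=> [/upper].
Qed.

Lemma sandwich_order_type_le k : a = k %[mod 3] ->
  ((0 < k)%N -> ~ S k%:R) ->
  has_order_type (S `&` `[0, k%:R]) (omega_pow 'I_k).
Proof.
case: k => [|k] ak nS.
  (* For k = 0 the section is the single point 0, the defect of 3, and [omega_pow 'I_0] has one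
     element. *)
  have S0 : S 0.
    apply: lower; rewrite (stable_defects_mod_eq R ak).
    have <- : defect 3 = 0 by rewrite defectE (@complexity_pow3 1%N) // (@lg3X R 1); lra.
    by apply: stable_defects_mod_intro stable3 _; rewrite (@complexity_pow3 1%N).
  have eq0 (u v : omega_pow 'I_0) : u = v by apply/fsfunP => -[].
  exists (fun=> 0); split; first split.
  - by move=> u _; split=> //=; rewrite in_itv /= lexx.
  - by move=> u v _ _ _; exact: eq0.
  - move=> x [_ /=]; rewrite in_itv /= -eq_le => /eqP <-.
    by exists (restrict_to [::] (fun=> 0%N)).
  - by move=> u v; rewrite ltxx; split=> // -[[]].
have -> : S `&` `[0, k.+1%:R] = S `&` [set y | y < k.+1%:R].
  apply/seteqP; split=> x [Sx /=].
    rewrite in_itv /= => /andP [_ le]; split=> //=; rewrite lt_neqAle le andbT.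
    by apply/eqP => eq; apply: nS; rewrite // -eq.
  by move=> lt; split=> //=; rewrite in_itv /= (ltW lt) (closure_expr_defects_ge0 (upper Sx)).
exact: sandwich_order_type_lt.
Qed.

Lemma sandwich_omega_omega :
  well_ordered S /\ has_order_type S (omega_pow nat).
Proof.
split; first exact: well_ordered_closure_expr_defects.
exact: order_type_omega_omega lower upper.
Qed.

End Sandwich.

(** The embedding that starts from 3 can be squeezed into any interval ending at [k]. *)
Lemma closure_stable_defects_mod_nat k : closure (stable_defects_mod R k) k%:R.
Proof.
apply/closure_near => eta eta0.
have [f [_ /(_ (fun=> 0%N)) [Df bnd]]] := @lex_embedding R k 3 eta stable3 eta0.
exists (f (fun=> 0%N)).
  rewrite (@stable_defects_mod_eq _ _ k) // in Df.
  by rewrite -modnDml (@complexity_pow3 1%N).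
move: bnd; rewrite defectE (@complexity_pow3 1%N) // (@lg3X R 1) ltr_norml; lra.
Qed.

Lemma closure_sandwich a (S : set R) :
  stable_defects_mod R a `<=` S -> S `<=` E ->
  [/\ stable_defects_mod R a `<=` closure S, closure S `<=` E &
    forall k, a = k %[mod 3] -> closure S k%:R].
Proof.
move=> lower upper; split.
- by move=> x /lower; exact: subset_closure.
- by move=> x /(closure_subset upper); rewrite -(proj1 (closure_id _)) //; exact: closed_closure.
- move=> k ak; apply: closure_subset lower _ _; rewrite (stable_defects_mod_eq R ak).
  exact: closure_stable_defects_mod_nat.
Qed.

Lemma closure_sandwich_nth a (S : set R) k :
  stable_defects_mod R a `<=` S -> S `<=` E -> (1 <= k)%N -> a = k %[mod 3] ->
  [/\ has_order_type (closure S `&` `[0, k%:R]) (succ_ordinal (omega_pow 'I_k)),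
      (closure S `&` `[0, k%:R]) k%:R,
      is_nth_element (closure S `&` `[0, k%:R]) (omega_pow 'I_k) k%:R &
      is_nth_element (closure S) (omega_pow 'I_k) k%:R].
Proof.
move=> lower upper k1 ak.
have [clower cupper cnat] := closure_sandwich lower upper.
have Sk := cnat _ ak.
have ge0 x : closure S x -> 0 <= x by move=> /cupper /closure_expr_defects_ge0.
have lt := sandwich_order_type_lt clower cupper k1 ak.
have Ik : (closure S `&` `[0, k%:R]) k%:R.
  by split=> //=; rewrite in_itv /= ler0n lexx.
split=> //; first exact: order_type_omega_succ.
split=> //; suff -> : closure S `&` `[0, k%:R] `&` [set y | y < k%:R] =
    closure S `&` [set y | y < k%:R] by [].
apply/seteqP; split=> x /=; first by move=> [[]].
by move=> [Sx xk]; split=> //; split=> //=; rewrite in_itv /= ge0 //= ltW.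
Qed.

Lemma defects_sub : defects R `<=` E.
Proof. by move=> _ [n n0 <-]; exact: defect_closure. Qed.

Lemma stable_defects_sub : stable_defects R `<=` defects R.
Proof. by move=> _ [n [n0 _] <-]; exists n. Qed.

Lemma defects_mod_sub a : defects_mod R a `<=` defects R.
Proof. by move=> _ [n [n0 _ _] <-]; exists n. Qed.

Lemma stable_defects_mod_stable a : stable_defects_mod R a `<=` stable_defects R.
Proof. by move=> x []. Qed.

Lemma stable_defects_mod_defects_mod a : stable_defects_mod R a `<=` defects_mod R a.
Proof. by move=> x []. Qed.

End OrderTypes.

Theorem theorem7p4 (R : realType) :
  (* (1) *)
  ((well_ordered (defects R) /\
    has_order_type (defects R) (omega_pow nat)) /\
   (well_ordered (stable_defects R) /\
    has_order_type (stable_defects R) (omega_pow nat)) /\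
   (forall k : nat,
      has_order_type (stable_defects R `&` `[0, k%:R]) (omega_pow 'I_k)) /\
   (forall k : nat, k <> 1%N ->
      has_order_type (defects R `&` `[0, k%:R]) (omega_pow 'I_k))) /\
  (* (2) *)
  ((well_ordered (closure (stable_defects R)) /\
    has_order_type (closure (stable_defects R)) (omega_pow nat)) /\
   (well_ordered (closure (defects R)) /\
    has_order_type (closure (defects R)) (omega_pow nat)) /\
   (forall k : nat, (1 <= k)%N ->
      [/\ has_order_type (closure (stable_defects R) `&` `[0, k%:R])
            (succ_ordinal (omega_pow 'I_k)),
          (closure (stable_defects R) `&` `[0, k%:R]) k%:R,
          is_nth_element (closure (stable_defects R) `&` `[0, k%:R])
            (omega_pow 'I_k) k%:R &
          is_nth_element (closure (stable_defects R)) (omega_pow 'I_k) k%:R] /\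
      [/\ has_order_type (closure (defects R) `&` `[0, k%:R])
            (succ_ordinal (omega_pow 'I_k)),
          (closure (defects R) `&` `[0, k%:R]) k%:R,
          is_nth_element (closure (defects R) `&` `[0, k%:R])
            (omega_pow 'I_k) k%:R &
          is_nth_element (closure (defects R)) (omega_pow 'I_k) k%:R])) /\
  (* (3) *)
  (forall a : nat, (a < 3)%N ->
   (well_ordered (defects_mod R a) /\
    has_order_type (defects_mod R a) (omega_pow nat)) /\
   (well_ordered (stable_defects_mod R a) /\
    has_order_type (stable_defects_mod R a) (omega_pow nat)) /\
   (forall k : nat, a = k %[mod 3] ->
      has_order_type (defects_mod R a `&` `[0, k%:R]) (omega_pow 'I_k) /\
      has_order_type (stable_defects_mod R a `&` `[0, k%:R])
        (omega_pow 'I_k))) /\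
  (* (4) *)
  (forall a : nat, (a < 3)%N ->
   (well_ordered (closure (defects_mod R a)) /\
    has_order_type (closure (defects_mod R a)) (omega_pow nat)) /\
   (well_ordered (closure (stable_defects_mod R a)) /\
    has_order_type (closure (stable_defects_mod R a)) (omega_pow nat)) /\
   (forall k : nat, (1 <= k)%N -> a = k %[mod 3] ->
      [/\ has_order_type (closure (defects_mod R a) `&` `[0, k%:R])
            (succ_ordinal (omega_pow 'I_k)),
          (closure (defects_mod R a) `&` `[0, k%:R]) k%:R,
          is_nth_element (closure (defects_mod R a) `&` `[0, k%:R])
            (omega_pow 'I_k) k%:R &
          is_nth_element (closure (defects_mod R a)) (omega_pow 'I_k) k%:R] /\
      [/\ has_order_type (closure (stable_defects_mod R a) `&` `[0, k%:R])
            (succ_ordinal (omega_pow 'I_k)),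
          (closure (stable_defects_mod R a) `&` `[0, k%:R]) k%:R,
          is_nth_element (closure (stable_defects_mod R a) `&` `[0, k%:R])
            (omega_pow 'I_k) k%:R &
          is_nth_element (closure (stable_defects_mod R a))
            (omega_pow 'I_k) k%:R])).
Proof.
pose D := defects R; pose Ds := stable_defects R.
have uD : D `<=` closure (expr_defects R) := @defects_sub R.
have uDs : Ds `<=` closure (expr_defects R).
  by move=> x /stable_defects_sub /uD.
have lDs a : stable_defects_mod R a `<=` Ds := @stable_defects_mod_stable R a.
have lD a : stable_defects_mod R a `<=` D by move=> x /lDs /stable_defects_sub.
have lDa a : stable_defects_mod R a `<=` defects_mod R a.
  exact: stable_defects_mod_defects_mod.
have uDa a : defects_mod R a `<=` closure (expr_defects R).
  by move=> x /defects_mod_sub /uD.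
have lDas a : stable_defects_mod R a `<=` stable_defects_mod R a by [].
have uDas a : stable_defects_mod R a `<=` closure (expr_defects R).
  by move=> x /lDs /uDs.
have omega_omega_closure a S : stable_defects_mod R a `<=` S ->
    S `<=` closure (expr_defects R) ->
    well_ordered (closure S) /\ has_order_type (closure S) (omega_pow nat).
  move=> lS uS; have [lS' uS' _] := closure_sandwich lS uS.
  exact: sandwich_omega_omega lS' uS'.
split; last split; last split.
(* The undivided sets contain every class: class 0 serves for the whole order type, the class of [k]
   for the section at [k]. *)
- split; first exact: sandwich_omega_omega (lD 0%N) uD.
  split; first exact: sandwich_omega_omega (lDs 0%N) uDs.
  split=> k => [|k1].
    apply: (sandwich_order_type_le (lDs k) uDs) => // k0 Sk.
    exact: stable_defects_neq_nat Sk k0 erefl.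
  (* A defect equal to k > 0 belongs to the number 1 and forces k = 1, the excluded value. *)
  apply: (sandwich_order_type_le (lD k) uD) => // k0 [n n0 hn].
  have n1 := defect_eq_nat n0 k0 hn; move: hn; rewrite n1 defect1 => /esym/eqP.
  by rewrite pnatr_eq1 => /eqP.
- split; first exact: omega_omega_closure (lDs 0%N) uDs.
  split; first exact: omega_omega_closure (lD 0%N) uD.
  move=> k k1; split; first exact: closure_sandwich_nth (lDs k) uDs k1 erefl.
  exact: closure_sandwich_nth (lD k) uD k1 erefl.
- move=> a _; split; first exact: sandwich_omega_omega (lDa a) (uDa a).
  split; first exact: sandwich_omega_omega (lDas a) (uDas a).
  move=> k ak; split.
    (* The number 1, the only one with a positive integer defect, is excluded from [defects_mod], so
       k = 1 is no exception. *)
    apply: (sandwich_order_type_le (lDa a) (uDa a)) => // k0 [n [n0 _ n1] hn].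
    exact: n1 (defect_eq_nat n0 k0 hn).
  apply: (sandwich_order_type_le (lDas a) (uDas a)) => // k0 /lDs Sk.
  exact: stable_defects_neq_nat Sk k0 erefl.
- move=> a _; split; first exact: omega_omega_closure (lDa a) (uDa a).
  split; first exact: omega_omega_closure (lDas a) (uDas a).
  move=> k k1 ak; split; first exact: closure_sandwich_nth (lDa a) (uDa a) k1 ak.
  exact: closure_sandwich_nth (lDas a) (uDas a) k1 ak.
Qed.
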